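(* There exist a $C^*$-algebra $\mathfrak{A}$, a Hilbert $C^*$-module $\mathscr{H}$ over $\mathfrak{A}$, and two projections $P$ and $Q$ in $\mathcal{L}(\mathscr{H})$ such that the operator equation $$(P+Q)^{1/2}X=P,\quad X\in\mathcal{L}(\mathscr{H})$$ has no solution.
   Context: $\mathcal{L}(\mathscr{H})$ denotes the $C^*$-algebra of adjointable operators on the Hilbert $C^*$-module $\mathscr{H}$; a projection is a self-adjoint idempotent in $\mathcal{L}(\mathscr{H})$. *)

(* Defs.v *)
From HB Require Import structures.
From mathcomp Require Import all_boot all_order all_algebra.
From mathcomp Require Import complex.
From mathcomp Require Import all_classical all_reals all_analysis.

Set Implicit Arguments.
Unset Strict Implicit.
Unset Printing Implicit Defensive.

Import Order.TTheory GRing.Theory Num.Theory numFieldNormedType.Exports.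

Local Open Scope classical_set_scope.
Local Open Scope complex_scope.
Local Open Scope ring_scope.

(* C*-algebras need not be unital, hence the multiplication is not that of a
   MathComp ring. On the complex field R[i], 0 <= z means that z is real and
   nonnegative, and norms are elements of R[i]. *)
HB.mixin Record CompleteNormedModule_isCStarAlg (R : realType) A
    of CompleteNormedModule R[i] A := {
  cmul : A -> A -> A;
  cstar : A -> A;
  cmulA : forall a b c, cmul a (cmul b c) = cmul (cmul a b) c;
  cmulDl : forall a b c, cmul (a + b) c = cmul a c + cmul b c;
  cmulDr : forall a b c, cmul a (b + c) = cmul a b + cmul a c;
  cmulZl : forall (k : R[i]) a b, cmul (k *: a) b = k *: cmul a b;
  cmulZr : forall (k : R[i]) a b, cmul a (k *: b) = k *: cmul a b;
  cnormM : forall a b, `|cmul a b| <= `|a| * `|b|;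
  cstarK : forall a, cstar (cstar a) = a;
  cstarD : forall a b, cstar (a + b) = cstar a + cstar b;
  cstarZ : forall (k : R[i]) a, cstar (k *: a) = Num.conj k *: cstar a;
  cstarM : forall a b, cstar (cmul a b) = cmul (cstar b) (cstar a);
  cnorm_star_mul : forall a, `|cmul (cstar a) a| = `|a| ^+ 2
}.

#[short(type="cstarAlgType")]
HB.structure Definition CStarAlg (R : realType) :=
  {A of CompleteNormedModule_isCStarAlg R A & CompleteNormedModule R[i] A}.

Section CStarPositive.
Variables (R : realType) (A : cstarAlgType R).

(* Multiplication of the unitization A (+) C, whose unit is (0, 1). *)
Definition unitization_mul (x y : A * R[i]) : A * R[i] :=
  (cmul x.1 y.1 + x.2 *: y.1 + y.2 *: x.1, x.2 * y.2).

(* The spectrum is computed in the unitization. When A already has a unit this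
   adds at most the point 0 to the spectrum relative to A, which does not
   affect positivity. *)
Definition cspectrum (a : A) : set R[i] :=
  [set l | ~ exists y : A * R[i],
     unitization_mul (a, - l) y = (0, 1) /\
     unitization_mul y (a, - l) = (0, 1)].

Definition cpositive (a : A) : Prop :=
  cstar a = a /\ forall l, cspectrum a l -> 0 <= l.

End CStarPositive.

(* Right Hilbert modules, the inner product being linear in its second
   variable. The axiom hnorm_ip says that the Banach space norm of the carrier
   is |<x, x>|^(1/2). *)
HB.mixin Record CompleteNormedModule_isHilbertMod (R : realType)
    (A : cstarAlgType R) H of CompleteNormedModule R[i] H := {
  hact : H -> A -> H;
  hip : H -> H -> A;
  hactM : forall x a b, hact (hact x a) b = hact x (cmul a b);
  hactDl : forall x y a, hact (x + y) a = hact x a + hact y a;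
  hactDr : forall x a b, hact x (a + b) = hact x a + hact x b;
  hactZl : forall (k : R[i]) x a, hact (k *: x) a = k *: hact x a;
  hactZr : forall (k : R[i]) x a, hact x (k *: a) = k *: hact x a;
  hipDr : forall x y z, hip x (y + z) = hip x y + hip x z;
  hipZr : forall (k : R[i]) x y, hip x (k *: y) = k *: hip x y;
  hip_act : forall x y a, hip x (hact y a) = cmul (hip x y) a;
  hip_star : forall x y, cstar (hip x y) = hip y x;
  hip_positive : forall x, cpositive (hip x x);
  hip_eq0 : forall x, hip x x = 0 -> x = 0;
  hnorm_ip : forall x, `|x| ^+ 2 = `|hip x x|
}.

#[short(type="hilbertModType")]
HB.structure Definition HilbertMod (R : realType) (A : cstarAlgType R) :=
  {H of CompleteNormedModule_isHilbertMod R A H & CompleteNormedModule R[i] H}.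

Section AdjointableOperators.
Variables (R : realType) (A : cstarAlgType R) (H : hilbertModType A).

Definition is_adjoint (T S : H -> H) : Prop :=
  forall x y, hip (T x) y = hip x (S y).

(* An adjointable map is automatically A-linear and bounded. *)
Definition adjointable : set (H -> H) := [set T | exists S, is_adjoint T S].

Definition self_adjoint (T : H -> H) : Prop := is_adjoint T T.

Definition projection (P : H -> H) : Prop :=
  [/\ adjointable P, self_adjoint P & P \o P = P].

(* Spectrum in the unital C*-algebra of adjointable operators: the resolvent
   has to be adjointable. *)
Definition op_spectrum (T : H -> H) : set R[i] :=
  [set l | ~ exists S, [/\ adjointable S,
     (fun x => T x - l *: x) \o S = id & S \o (fun x => T x - l *: x) = id]].

Definition op_positive (T : H -> H) : Prop :=
  [/\ adjointable T, self_adjoint T & forall l, op_spectrum T l -> 0 <= l].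

(* S = T^(1/2): a positive element of a C*-algebra has exactly one positive
   square root. *)
Definition is_positive_sqrt (T S : H -> H) : Prop :=
  op_positive S /\ S \o S = T.

End AdjointableOperators.

(* Main.v *)
Require Import Defs.
From HB Require Import structures.
From mathcomp Require Import all_boot all_order all_algebra complex.
From mathcomp Require Import all_classical all_reals all_analysis.
From mathcomp Require Import ring lra.

(** For operators on a Hilbert space, P <= P + Q already makes P factor through
    (P + Q)^(1/2). On a Hilbert module the factorization can exist at every
    point of the underlying space without depending on the point in a way that
    the module allows; 2 x 2 matrices are enough to see this.

    Let A be the algebra of bounded complex sequences and H the module of pairs
    (x, y) where x is a bounded sequence and y a sequence tending to 0, with
    <(x, y), (x', y')> = conj x * x' + conj y * y'. A real symmetric matrix of
    bounded sequences acts on H when its off-diagonal entry tends to 0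
    ([symmx_op]). Take s n = 1 / (n + 1) and c n = sqrt (1 - s n ^ 2). As
    c ^ 2 + s ^ 2 = 1 and s tends to 0, the orthogonal projections of the plane
    onto the lines spanned by (c n, s n) and (c n, - s n) give projections P
    and Q of H ([line_projection]). The off-diagonal entries of P and Q cancel,
    so P + Q = diag (2 c ^ 2, 2 s ^ 2), which has the evident positive square
    root S = diag (sqrt 2 * c, sqrt 2 * s) ([diag_op_positive]).

    Suppose S X = P and evaluate at (1, 0). The second coordinate y of X (1, 0)
    satisfies sqrt 2 * s * y = c * s, hence y = c / sqrt 2, which tends to
    1 / sqrt 2. But the second coordinate of an element of H tends to 0.

    Both A and H belong to one family of Banach spaces [seqpair], which differ
    in the filter along which the second sequence tends to 0; the supremum norm
    and its completeness are therefore treated once. *)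

Set Implicit Arguments.
Unset Strict Implicit.
Unset Printing Implicit Defensive.

Import Order.TTheory GRing.Theory Num.Theory numFieldNormedType.Exports.
Import Normc.

Local Open Scope classical_set_scope.
Local Open Scope complex_scope.
Local Open Scope ring_scope.

(** * Moduli of complex numbers and the norm of the complex plane C^2 *)

Section ComplexModulus.
Variable R : realType.
Implicit Types x y : R[i].

Lemma normcD x y : normc (x + y) <= normc x + normc y.
Proof. exact: le_normcD. Qed.

Lemma normc_ge0 x : 0 <= normc x.
Proof. by case: x => a b; exact: sqrtr_ge0. Qed.

Lemma normc_conj x : normc x^* = normc x.
Proof. by case: x => a b /=; rewrite sqrrN. Qed.

Lemma normc_real (a : R) : normc a%:C = `|a|.
Proof. by rewrite /= expr0n addr0 sqrtr_sqr. Qed.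

Lemma mulcJ x : x^* * x = (normc x ^+ 2)%:C.
Proof. by rewrite mulrC -sqr_normc rmorphXn. Qed.

Lemma Re_le_normc x : `|complex.Re x| <= normc x.
Proof.
by case: x => a b /=; rewrite -sqrtr_sqr ler_wsqrtr // lerDl sqr_ge0.
Qed.

Lemma Im_le_normc x : `|complex.Im x| <= normc x.
Proof.
by case: x => a b /=; rewrite -sqrtr_sqr ler_wsqrtr // lerDr sqr_ge0.
Qed.

Lemma normc_le_ReIm x : normc x <= `|complex.Re x| + `|complex.Im x|.
Proof.
case: x => a b /=; rewrite -[leRHS]ger0_norm ?addr_ge0// -sqrtr_sqr.
rewrite ler_wsqrtr // sqrrD !real_normK ?num_real//.
have := mulr_ge0 (normr_ge0 a) (normr_ge0 b); lra.
Qed.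

Definition norm2 x y : R := Num.sqrt (normc x ^+ 2 + normc y ^+ 2).

Lemma norm2_ge0 x y : 0 <= norm2 x y. Proof. exact: sqrtr_ge0. Qed.

Lemma norm2_sqr x y : norm2 x y ^+ 2 = normc x ^+ 2 + normc y ^+ 2.
Proof. by rewrite sqr_sqrtr // addr_ge0 ?sqr_ge0. Qed.

Lemma norm2_l x : norm2 x 0 = normc x.
Proof.
by rewrite /norm2 normc0 expr0n addr0 sqrtr_sqr ger0_norm ?normc_ge0.
Qed.

Lemma normc_le_norm2_l x y : normc x <= norm2 x y.
Proof.
by rewrite -[leLHS]ger0_norm ?normc_ge0// -sqrtr_sqr ler_wsqrtr//
  lerDl sqr_ge0.
Qed.

Lemma normc_le_norm2_r x y : normc y <= norm2 x y.
Proof.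
by rewrite -[leLHS]ger0_norm ?normc_ge0// -sqrtr_sqr ler_wsqrtr//
  lerDr sqr_ge0.
Qed.

Lemma norm2_le_add x y : norm2 x y <= normc x + normc y.
Proof.
rewrite -[leRHS]ger0_norm ?addr_ge0 ?normc_ge0// -sqrtr_sqr ler_wsqrtr //.
have := mulr_ge0 (normc_ge0 x) (normc_ge0 y); nra.
Qed.

Lemma norm2Z k x y : norm2 (k * x) (k * y) = normc k * norm2 x y.
Proof.
rewrite /norm2 !normcM !exprMn -mulrDr sqrtrM ?sqr_ge0//.
by rewrite sqrtr_sqr ger0_norm ?normc_ge0.
Qed.

(** The moduli of the coordinates are the coordinates of a plane vector, so
    this is the triangle inequality of the complex modulus. *)
Lemma norm2D x y x' y' : norm2 (x + x') (y + y') <= norm2 x y + norm2 x' y'.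
Proof.
apply: le_trans (normcD (normc x +i* normc y) (normc x' +i* normc y')).
apply: ler_wsqrtr.
by rewrite lerD// lerXn2r ?nnegrE ?addr_ge0 ?normc_ge0 ?normcD.
Qed.

End ComplexModulus.

(** * Pairs of bounded sequences *)

Section SequencePairs.
Variable R : realType.
Implicit Types (F : filter_on nat) (f g : nat -> R[i]).

Definition bdd f := exists M : R, forall n, normc (f n) <= M.

Definition vanishes F f :=
  forall e : R, 0 < e -> \forall n \near F, normc (f n) <= e.

Lemma bddD f g : bdd f -> bdd g -> bdd (f + g).
Proof.
move=> [M hM] [N hN]; exists (M + N) => n.
exact: le_trans (normcD _ _) (lerD (hM n) (hN n)).
Qed.

Lemma bddM f g : bdd f -> bdd g -> bdd (f * g).
Proof.
move=> [M hM] [N hN]; exists (M * N) => n.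
by rewrite normcM ler_pM ?normc_ge0.
Qed.

Lemma bdd_cst (k : R[i]) : bdd (fun=> k).
Proof. by exists (normc k). Qed.

Lemma bdd_conj f : bdd f -> bdd (fun n => (f n)^*).
Proof. by move=> [M hM]; exists M => n; rewrite normc_conj. Qed.

Lemma vanishesD F f g : vanishes F f -> vanishes F g -> vanishes F (f + g).
Proof.
move=> vf vg e e0; have e20 : 0 < e / 2 by rewrite divr_gt0.
apply: filterS2 (vf _ e20) (vg _ e20) => n fn gn.
by apply: le_trans (normcD _ _) _; rewrite [e]splitr lerD.
Qed.

Lemma vanishesM F f g : bdd f -> vanishes F g -> vanishes F (f * g).
Proof.
move=> [M hM] vg e e0.
have M0 : 0 < Num.max M 1 by rewrite lt_max ltr01 orbT.
apply: filterS (vg (e / Num.max M 1) (divr_gt0 e0 M0)) => n gn.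
rewrite normcM -(divfK (lt0r_neq0 M0) e) [leRHS]mulrC.
by rewrite ler_pM ?normc_ge0// le_max hM.
Qed.

Lemma vanishes0 F : vanishes F 0.
Proof. by move=> e e0; apply: nearW => n; rewrite normc0 ltW. Qed.

Lemma vanishes_conj F f : vanishes F f -> vanishes F (fun n => (f n)^*).
Proof. by move=> vf e /vf; apply: filterS => n; rewrite normc_conj. Qed.

(** The only member of the trivial filter is the whole of nat, so smallness
    along it is smallness everywhere. *)
Lemma vanishes_trivial f : vanishes (trivial_filter_on nat) f -> f = 0.
Proof.
move=> vf; apply/funext => n; apply: eq0_normc; apply/eqP.
rewrite eq_le normc_ge0 andbT; apply/ler_addgt0Pr => e e0; rewrite add0r.
have all_n : [set n | normc (f n) <= e] = setT by exact: vf e0.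
suff : [set n | normc (f n) <= e] n by [].
by rewrite all_n.
Qed.

Definition seqpair_pred F : {pred (nat -> R[i]) * (nat -> R[i])} :=
  fun x => `[< [/\ bdd x.1, bdd x.2 & vanishes F x.2] >].

(** The second sequence vanishes along a filter F that is left free. For the
    filter of cofinite sets this is the Hilbert module; for the trivial filter
    the second sequence is 0 and what remains is the C*-algebra of bounded
    sequences. *)
Record seqpair F := SeqPair {
  seqpair_val :> (nat -> R[i]) * (nat -> R[i]);
  _ : seqpair_val \in seqpair_pred F }.

HB.instance Definition _ F := [isSub for @seqpair_val F].
HB.instance Definition _ F := [Choice of seqpair F by <:].

Lemma seqpair_submod_closed F : submod_closed (seqpair_pred F).
Proof.
split; first by apply/asboolP; split; [exact: bdd_cst..|exact: vanishes0].
move=> k x y /asboolP[x1 x2 vx] /asboolP[y1 y2 vy]; apply/asboolP; split => /=.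
- by apply: bddD => //; apply: bddM (bdd_cst k) _.
- by apply: bddD => //; apply: bddM (bdd_cst k) _.
- by apply: vanishesD => //; apply: vanishesM (bdd_cst k) _.
Qed.

HB.instance Definition _ F :=
  GRing.isSubmodClosed.Build _ _ (seqpair_pred F) (seqpair_submod_closed F).
HB.instance Definition _ F := [SubChoice_isSubLmodule of seqpair F by <:].

End SequencePairs.

(** * The supremum norm *)

Section SupNorm.
Variables (R : realType) (F : filter_on nat).
Local Notation E := (seqpair R F).
Implicit Types x y : E.

Lemma seqpairP x : [/\ bdd x.1, bdd x.2 & vanishes F x.2].
Proof. exact/asboolP/(valP x). Qed.

Lemma seqpair_ext x y :
  (forall n, x.1 n = y.1 n) -> (forall n, x.2 n = y.2 n) -> x = y.
Proof.
move=> e1 e2; apply: val_inj => /=.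
by rewrite [LHS]surjective_pairing [RHS]surjective_pairing; congr pair;
  apply/funext.
Qed.

(** The value is 0 when (f, g) is not in the space; this makes operators on
    [seqpair] definable without carrying proofs in their arguments. *)
Definition mk_seqpair (f g : nat -> R[i]) : E := insubd 0 (f, g).

Lemma mk_seqpairE f g : bdd f -> bdd g -> vanishes F g ->
  seqpair_val (mk_seqpair f g) = (f, g).
Proof. by move=> bf bg vg; rewrite val_insubd ifT//; apply/asboolP. Qed.

Lemma seqpairD1 x y n : (x + y).1 n = x.1 n + y.1 n. Proof. by []. Qed.
Lemma seqpairD2 x y n : (x + y).2 n = x.2 n + y.2 n. Proof. by []. Qed.
Lemma seqpairN1 x n : (- x).1 n = - x.1 n. Proof. by []. Qed.
Lemma seqpairN2 x n : (- x).2 n = - x.2 n. Proof. by []. Qed.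
Lemma seqpairZ1 k x n : (k *: x).1 n = k * x.1 n. Proof. by []. Qed.
Lemma seqpairZ2 k x n : (k *: x).2 n = k * x.2 n. Proof. by []. Qed.

Definition supnorm x : R := sup (range (fun n => norm2 (x.1 n) (x.2 n))).

Lemma norm2_le_supnorm x n : norm2 (x.1 n) (x.2 n) <= supnorm x.
Proof.
apply: ub_le_sup; last by exists n.
have [[M hM] [N hN] _] := seqpairP x; exists (M + N) => _ [k _ <-].
exact: le_trans (norm2_le_add _ _) (lerD (hM k) (hN k)).
Qed.

Lemma supnorm_le x (r : R) :
  (forall n, norm2 (x.1 n) (x.2 n) <= r) -> supnorm x <= r.
Proof.
move=> xr; apply: ge_sup => [|_ [n _ <-]//].
by exists (norm2 (x.1 0%N) (x.2 0%N)), 0%N.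
Qed.

Lemma normc_fstB_le x y n : normc (x.1 n - y.1 n) <= supnorm (x - y).
Proof.
rewrite -seqpairN1 -seqpairD1.
exact: le_trans (normc_le_norm2_l _ _) (norm2_le_supnorm _ _).
Qed.

Lemma normc_sndB_le x y n : normc (x.2 n - y.2 n) <= supnorm (x - y).
Proof.
rewrite -seqpairN2 -seqpairD2.
exact: le_trans (normc_le_norm2_r _ _) (norm2_le_supnorm _ _).
Qed.

Lemma supnormB_le x y (r : R) :
  (forall n, normc (x.1 n - y.1 n) + normc (x.2 n - y.2 n) <= r) ->
  supnorm (x - y) <= r.
Proof.
move=> xyr; apply: supnorm_le => n.
rewrite seqpairD1 seqpairD2 seqpairN1 seqpairN2.
exact: le_trans (norm2_le_add _ _) (xyr n).
Qed.

Lemma supnorm_ge0 x : 0 <= supnorm x.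
Proof. exact: le_trans (norm2_ge0 _ _) (norm2_le_supnorm x 0). Qed.

Lemma supnormD x y : supnorm (x + y) <= supnorm x + supnorm y.
Proof.
apply: supnorm_le => n; rewrite seqpairD1 seqpairD2.
apply: le_trans (norm2D _ _ _ _) _.
by rewrite lerD ?norm2_le_supnorm.
Qed.

Lemma supnormZ_le k x : supnorm (k *: x) <= normc k * supnorm x.
Proof.
apply: supnorm_le => n; rewrite seqpairZ1 seqpairZ2 norm2Z.
by rewrite ler_wpM2l ?normc_ge0// norm2_le_supnorm.
Qed.

Lemma supnormZ k x : supnorm (k *: x) = normc k * supnorm x.
Proof.
apply/eqP; rewrite eq_le supnormZ_le /=.
have [->|k0] := eqVneq k 0; first by rewrite normc0 mul0r supnorm_ge0.
have nk0 : 0 < normc k.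
  rewrite lt_neqAle normc_ge0 andbT eq_sym.
  by apply: contra k0 => /eqP/eq0_normc ->.
have := supnormZ_le k^-1 (k *: x).
by rewrite scalerA mulVf// scale1r normcV ler_pdivlMl.
Qed.

Lemma supnorm_eq0 x : supnorm x = 0 -> x = 0.
Proof.
move=> x0; have h n : norm2 (x.1 n) (x.2 n) <= 0.
  by rewrite -x0 norm2_le_supnorm.
apply: seqpair_ext => n; apply: eq0_normc; apply/eqP;
  rewrite eq_le normc_ge0 andbT.
  exact: le_trans (normc_le_norm2_l _ _) (h n).
exact: le_trans (normc_le_norm2_r _ _) (h n).
Qed.

Definition cnorm x : R[i] := (supnorm x)%:C.

Lemma cnormD x y : cnorm (x + y) <= cnorm x + cnorm y.
Proof. by rewrite -rmorphD lecR supnormD. Qed.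

Lemma cnormZ k x : cnorm (k *: x) = `|k| * cnorm x.
Proof. by rewrite /cnorm supnormZ rmorphM. Qed.

Lemma cnorm_eq0 x : cnorm x = 0 -> x = 0.
Proof. by move=> /complexI/supnorm_eq0. Qed.

HB.instance Definition _ := isPointed.Build E 0.
HB.instance Definition _ :=
  Lmodule_isNormed.Build R[i] E cnormD cnormZ cnorm_eq0.

Lemma seqpair_normE x : `|x| = (supnorm x)%:C.
Proof. by []. Qed.

End SupNorm.

(** * Completeness *)

Section Complete.
Variables (R : realType) (F : filter_on nat).
Local Notation E := (seqpair R F).

Lemma seqpair_ball (x y : E) (e : R) :
  ball x e%:C y = (supnorm (x - y) < e) :> Prop.
Proof. by rewrite -ball_normE /ball_ /= seqpair_normE ltcR. Qed.

(** Completeness of the reals gives the limit l of phi along G. The bound is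
    uniform: how far l is from phi x depends only on a radius e for which G
    contains the ball around x, and neither on phi nor on a speed of
    convergence. Applied to all coordinates at once, it turns coordinatewise
    limits into a limit for the supremum norm. *)
Lemma cauchy_lip_limit (G : set_system E) (phi : E -> R) :
  ProperFilter G -> cauchy G ->
  (forall x y, `|phi x - phi y| <= supnorm (x - y)) ->
  exists l, forall x e, G (ball x e%:C) -> `|l - phi x| <= e.
Proof.
move=> GG /cauchyP cG lip.
have : cauchy (phi @ G).
  apply: cauchy_exP => e e0.
  have [|x Gx] := cG e%:C; first by rewrite ltcR.
  exists (phi x); rewrite /nbhs /=; apply: filterS Gx => y.
  rewrite seqpair_ball => xy.
  by rewrite -ball_normE; exact: le_lt_trans (lip _ _) xy.
move/cauchy_cvg/cvg_ex => [l /cvgrPdist_le /= Gl]; exists l => x e Gx.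
apply/ler_addgt0Pr => d d0.
have [y [/= ly]] := @filter_ex _ G _ _ (filterI (Gl d d0) Gx).
rewrite seqpair_ball => xy.
have -> : l - phi x = (l - phi y) - (phi x - phi y) by ring.
rewrite (le_trans (ler_normB _ _))// addrC lerD//.
exact: le_trans (lip _ _) (ltW xy).
Qed.

(** The factor 2 comes from estimating the real and imaginary parts
    separately. *)
Lemma cauchy_coord_limit (G : set_system E) (phi : E -> R[i]) :
  ProperFilter G -> cauchy G ->
  (forall x y, normc (phi x - phi y) <= supnorm (x - y)) ->
  exists l, forall x e, G (ball x e%:C) -> normc (l - phi x) <= e *+ 2.
Proof.
move=> GG cG lip.
have [x y|a ha] := @cauchy_lip_limit G (fun x => complex.Re (phi x)) GG cG.
  rewrite -raddfB; exact: le_trans (Re_le_normc _) (lip x y).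
have [x y|b hb] := @cauchy_lip_limit G (fun x => complex.Im (phi x)) GG cG.
  rewrite -raddfB; exact: le_trans (Im_le_normc _) (lip x y).
exists (a +i* b) => x e Gx; apply: le_trans (normc_le_ReIm _) _.
by rewrite !raddfB /= mulr2n lerD ?ha ?hb.
Qed.

(** A uniform limit of pairs is again a pair of the same kind: it is within a
    fixed distance of some member x of the space, which gives boundedness, and
    within an arbitrarily small distance of such an x, which makes the second
    sequence vanish. *)
Lemma seqpair_complete (G : set_system E) : ProperFilter G -> cauchy G -> cvg G.
Proof.
move=> GG cG.
have /choice[f hf] n : exists l, forall x e, G (ball x e%:C) ->
    normc (l - x.1 n) <= e *+ 2.
  by apply: (@cauchy_coord_limit G _ GG cG) => x y; exact: normc_fstB_le.
have /choice[g hg] n : exists l, forall x e, G (ball x e%:C) ->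
    normc (l - x.2 n) <= e *+ 2.
  by apply: (@cauchy_coord_limit G _ GG cG) => x y; exact: normc_sndB_le.
have center (e : R) : 0 < e -> exists x, G (ball x e%:C).
  by move=> e0; have /cauchyP := cG; apply; rewrite ltcR.
have [x1 Gx1] := center 1 ltr01; have [bx1 bx2 _] := seqpairP x1.
have bf : bdd f.
  have [M hM] := bx1; exists (1 *+ 2 + M) => n.
  rewrite -[f n](subrK (x1.1 n)); apply: le_trans (normcD _ _) _.
  by rewrite lerD// hf.
have bg : bdd g.
  have [M hM] := bx2; exists (1 *+ 2 + M) => n.
  rewrite -[g n](subrK (x1.2 n)); apply: le_trans (normcD _ _) _.
  by rewrite lerD// hg.
have vg : vanishes F g.
  (* The error is 2 * (e / 4) from the limit and e / 4 from x. *)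
  move=> e e0; have e40 : 0 < e / 4 by rewrite divr_gt0.
  have [x Gx] := center _ e40; have [_ _ vx] := seqpairP x.
  apply: filterS (vx _ e40) => n xn.
  rewrite -[g n](subrK (x.2 n)); apply: le_trans (normcD _ _) _.
  have := hg n x _ Gx; lra.
pose l := mk_seqpair F f g.
have lE : seqpair_val l = (f, g) by exact: mk_seqpairE.
apply/cvg_ex; exists l; apply/cvgrPdist_lt => e e0.
(* A positive complex number is real. *)
have {}e0 : 0 < complex.Re e /\ e = (complex.Re e)%:C.
  by case: e e0 => a b; rewrite ltcE /= => /andP[/eqP -> ->].
case: e0 => + ->; set r := complex.Re e => r0.
have r80 : 0 < r / 8 by rewrite divr_gt0.
(* Each of the two sequences of l - x is bounded by 2 * (r / 8). *)
have [x Gx] := center _ r80; apply: filterS (Gx) => y.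
rewrite seqpair_ball => xy; rewrite seqpair_normE ltcR.
have lx : supnorm (l - x) <= r / 2.
  apply: supnormB_le => n; rewrite lE /=.
  have := hf n x _ Gx; have := hg n x _ Gx; lra.
have -> : l - y = (l - x) + (x - y) by rewrite addrA subrK.
apply: le_lt_trans (supnormD _ _) _; lra.
Qed.

HB.instance Definition _ := Uniform_isComplete.Build E seqpair_complete.

End Complete.

(** * The C*-algebra of bounded sequences *)

Section BoundedSequences.
Variable R : realType.
Local Notation E := (seqpair R).

Definition linfty := E (trivial_filter_on nat).
HB.instance Definition _ := CompleteNormedModule.copy linfty linfty.
Implicit Types a b c : linfty.

Lemma linfty_snd a n : a.2 n = 0.
Proof. by have [_ _ /vanishes_trivial ->] := seqpairP a. Qed.

Lemma linfty_ext a b : (forall n, a.1 n = b.1 n) -> a = b.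
Proof. by move=> ab; apply: seqpair_ext => // n; rewrite !linfty_snd. Qed.

Definition mk_linfty (f : nat -> R[i]) : linfty := mk_seqpair _ f 0.

Lemma mk_linftyE f n : bdd f -> (mk_linfty f).1 n = f n.
Proof.
by move=> bf; rewrite mk_seqpairE//; [exact: bdd_cst|exact: vanishes0].
Qed.

Lemma bdd_linfty a : bdd a.1. Proof. by have [] := seqpairP a. Qed.
Hint Resolve bdd_linfty : core.

Lemma normc_le_supnorm a n : normc (a.1 n) <= supnorm a.
Proof. by rewrite -norm2_l -(linfty_snd a n) norm2_le_supnorm. Qed.

Lemma linfty_supnorm_le a (r : R) :
  (forall n, normc (a.1 n) <= r) -> supnorm a <= r.
Proof. by move=> ar; apply: supnorm_le => n; rewrite linfty_snd norm2_l. Qed.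

(** The identity |<x, x>| = |x|^2 of Hilbert modules and, for x in the algebra
    itself, the C*-identity. *)
Lemma supnorm_sqr F (x : E F) a :
  (forall n, a.1 n = (norm2 (x.1 n) (x.2 n) ^+ 2)%:C) ->
  supnorm a = supnorm x ^+ 2.
Proof.
move=> ax; have na n : normc (a.1 n) = norm2 (x.1 n) (x.2 n) ^+ 2.
  by rewrite ax normc_real ger0_norm ?sqr_ge0.
apply/eqP; rewrite eq_le; apply/andP; split.
  apply: linfty_supnorm_le => n; rewrite na.
  by rewrite lerXn2r ?nnegrE ?norm2_ge0 ?supnorm_ge0 ?norm2_le_supnorm.
rewrite -[leRHS]sqr_sqrtr ?supnorm_ge0//.
rewrite lerXn2r ?nnegrE ?supnorm_ge0 ?sqrtr_ge0//.
apply: supnorm_le => n; rewrite -[leLHS]ger0_norm ?norm2_ge0// -sqrtr_sqr -na.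
by rewrite ler_wsqrtr ?normc_le_supnorm.
Qed.

Definition linfty_mul a b : linfty := mk_linfty (a.1 * b.1).
Definition linfty_star a : linfty := mk_linfty (fun n => (a.1 n)^*).

Lemma linfty_mulE a b n : (linfty_mul a b).1 n = a.1 n * b.1 n.
Proof. by rewrite mk_linftyE//; exact: bddM. Qed.

Lemma linfty_starE a n : (linfty_star a).1 n = (a.1 n)^*.
Proof. by rewrite mk_linftyE//; exact: bdd_conj. Qed.

Fact linfty_mulA a b c :
  linfty_mul a (linfty_mul b c) = linfty_mul (linfty_mul a b) c.
Proof. by apply: linfty_ext => n; rewrite !linfty_mulE mulrA. Qed.

Fact linfty_mulDl a b c :
  linfty_mul (a + b) c = linfty_mul a c + linfty_mul b c.
Proof.
by apply: linfty_ext => n; rewrite !(seqpairD1, linfty_mulE) mulrDl.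
Qed.

Fact linfty_mulDr a b c :
  linfty_mul a (b + c) = linfty_mul a b + linfty_mul a c.
Proof.
by apply: linfty_ext => n; rewrite !(seqpairD1, linfty_mulE) mulrDr.
Qed.

Fact linfty_mulZl (k : R[i]) a b :
  linfty_mul (k *: a) b = k *: linfty_mul a b.
Proof.
by apply: linfty_ext => n; rewrite !(seqpairZ1, linfty_mulE) mulrA.
Qed.

Fact linfty_mulZr (k : R[i]) a b :
  linfty_mul a (k *: b) = k *: linfty_mul a b.
Proof.
by apply: linfty_ext => n; rewrite !(seqpairZ1, linfty_mulE) mulrCA.
Qed.

Fact linfty_normM a b : `|linfty_mul a b| <= `|a| * `|b|.
Proof.
rewrite !seqpair_normE -rmorphM lecR; apply: linfty_supnorm_le => n.
by rewrite linfty_mulE normcM ler_pM ?normc_ge0 ?normc_le_supnorm.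
Qed.

Fact linfty_starK a : linfty_star (linfty_star a) = a.
Proof. by apply: linfty_ext => n; rewrite !linfty_starE conjCK. Qed.

Fact linfty_starD a b : linfty_star (a + b) = linfty_star a + linfty_star b.
Proof.
by apply: linfty_ext => n; rewrite !(seqpairD1, linfty_starE) rmorphD.
Qed.

Fact linfty_starZ (k : R[i]) a :
  linfty_star (k *: a) = Num.conj k *: linfty_star a.
Proof.
by apply: linfty_ext => n; rewrite !(seqpairZ1, linfty_starE) rmorphM.
Qed.

Fact linfty_starM a b :
  linfty_star (linfty_mul a b) = linfty_mul (linfty_star b) (linfty_star a).
Proof.
by apply: linfty_ext => n; rewrite !(linfty_mulE, linfty_starE) rmorphM mulrC.
Qed.

Fact linfty_norm_star_mul a : `|linfty_mul (linfty_star a) a| = `|a| ^+ 2.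
Proof.
rewrite !seqpair_normE -rmorphXn; congr (_%:C); apply: supnorm_sqr => n.
by rewrite linfty_mulE linfty_starE mulcJ linfty_snd norm2_l.
Qed.

HB.instance Definition _ := CompleteNormedModule_isCStarAlg.Build R linfty
  linfty_mulA linfty_mulDl linfty_mulDr linfty_mulZl linfty_mulZr linfty_normM
  linfty_starK linfty_starD linfty_starZ linfty_starM linfty_norm_star_mul.

(** A complex number off the half-line of nonnegative reals stays away from
    it; this makes the resolvent of a nonnegative sequence bounded. *)
Lemma dist_nonneg_reals (l : R[i]) : ~~ (0 <= l) ->
  exists2 d : R, 0 < d & forall t : R, 0 <= t -> d <= normc (t%:C - l).
Proof.
case: l => u v; rewrite lecE /= => nl.
have [v0|v0] := eqVneq v 0; last first.
  exists `|v|; rewrite ?normr_gt0// => t _.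
  by have := Im_le_normc (t%:C - (u +i* v)); rewrite /= sub0r normrN.
rewrite v0 eqxx /= -ltNge in nl *; exists (- u); rewrite ?oppr_gt0// => t t0.
apply: le_trans _ (Re_le_normc (t%:C - (u +i* 0))).
apply: le_trans _ (ler_norm _) => /=; lra.
Qed.

Lemma bdd_resolvent (r : nat -> R) (l : R[i]) : ~~ (0 <= l) ->
  (forall n, 0 <= r n) -> bdd (fun n => ((r n)%:C - l)^-1).
Proof.
move=> /dist_nonneg_reals[d d0 hd] r0; exists d^-1 => n.
by rewrite normcV lef_pV2 ?posrE ?hd// (lt_le_trans d0) ?hd.
Qed.

Lemma resolvent_neq0 (t : R) (l : R[i]) :
  ~~ (0 <= l) -> 0 <= t -> t%:C - l != 0.
Proof.
by move=> nl t0; apply: contra nl; rewrite subr_eq0 => /eqP <-; rewrite lecR.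
Qed.

(** The inverse of a - l is taken entrywise; it is bounded for l off the
    half-line, so no such l is in the spectrum. *)
Lemma linfty_positive a (r : nat -> R) : (forall n, 0 <= r n) ->
  (forall n, a.1 n = (r n)%:C) -> cpositive a.
Proof.
move=> r0 ar; split.
  by apply: linfty_ext => n; rewrite linfty_starE ar; exact: conjc_real.
move=> l; apply: contra_notT => nl.
have l0 : l != 0 by apply: contraNneq nl => ->.
(* In the unitization the inverse of (a, -l) has the form (b, - l^-1), and the
   first coordinate of the product vanishes for b = a / ((a - l) * l). *)
pose b := mk_linfty ((a.1 * fun n => ((r n)%:C - l)^-1) * fun=> l^-1).
have bE n : b.1 n = a.1 n * ((r n)%:C - l)^-1 * l^-1.
  rewrite mk_linftyE //.
  apply: bddM; last exact: bdd_cst.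
  by apply: bddM => //; exact: bdd_resolvent.
exists (b, - l^-1); split; rewrite /unitization_mul /=; congr pair.
- apply: linfty_ext => n; rewrite !(seqpairD1, seqpairZ1) linfty_mulE bE ar.
  by field; rewrite l0 resolvent_neq0.
- by rewrite mulrNN mulfV.
- apply: linfty_ext => n; rewrite !(seqpairD1, seqpairZ1) linfty_mulE bE ar.
  by field; rewrite l0 resolvent_neq0.
- by rewrite mulrNN mulVf.
Qed.

End BoundedSequences.

(** * The Hilbert module and its operators given by symmetric matrices *)

Section HilbertModuleOfSequencePairs.
Variables (R : realType) (F : filter_on nat).
Local Notation E := (seqpair R F).
Local Notation A := (linfty R).
Implicit Types (x y z : E) (a b : A).

Lemma bdd_fst x : bdd x.1. Proof. by have [] := seqpairP x. Qed.
Lemma bdd_snd x : bdd x.2. Proof. by have [] := seqpairP x. Qed.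
Lemma vanishes_snd x : vanishes F x.2. Proof. by have [] := seqpairP x. Qed.
Hint Resolve bdd_fst bdd_snd vanishes_snd : core.

Definition seqpair_act x a : E := mk_seqpair F (a.1 * x.1) (a.1 * x.2).

Definition seqpair_ip x y : A :=
  mk_linfty ((fun n => (x.1 n)^*) * y.1 + (fun n => (x.2 n)^*) * y.2).

Lemma seqpair_actE x a :
  seqpair_val (seqpair_act x a) = (a.1 * x.1, a.1 * x.2).
Proof.
have ba : bdd a.1 := bdd_linfty a.
by rewrite mk_seqpairE//; [exact: bddM|exact: bddM|exact: vanishesM].
Qed.

Lemma seqpair_act1 x a n : (seqpair_act x a).1 n = a.1 n * x.1 n.
Proof. by rewrite seqpair_actE. Qed.

Lemma seqpair_act2 x a n : (seqpair_act x a).2 n = a.1 n * x.2 n.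
Proof. by rewrite seqpair_actE. Qed.

Lemma seqpair_ipE x y n :
  (seqpair_ip x y).1 n = (x.1 n)^* * y.1 n + (x.2 n)^* * y.2 n.
Proof.
by rewrite mk_linftyE//; apply: bddD; apply: bddM => //; exact: bdd_conj.
Qed.

Lemma seqpair_ip_sqr x n :
  (seqpair_ip x x).1 n = (norm2 (x.1 n) (x.2 n) ^+ 2)%:C.
Proof. by rewrite seqpair_ipE !mulcJ norm2_sqr rmorphD. Qed.

Let simpE := (seqpairD1, seqpairD2, seqpairZ1, seqpairZ2, seqpair_act1,
  seqpair_act2, seqpair_ipE, linfty_mulE, linfty_starE).

Fact seqpair_actM x a b :
  seqpair_act (seqpair_act x a) b = seqpair_act x (cmul a b).
Proof. by apply: seqpair_ext => n; rewrite !simpE mulrA [b.1 n * _]mulrC. Qed.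

Fact seqpair_actDl x y a :
  seqpair_act (x + y) a = seqpair_act x a + seqpair_act y a.
Proof. by apply: seqpair_ext => n; rewrite !simpE mulrDr. Qed.

Fact seqpair_actDr x a b :
  seqpair_act x (a + b) = seqpair_act x a + seqpair_act x b.
Proof. by apply: seqpair_ext => n; rewrite !simpE mulrDl. Qed.

Fact seqpair_actZl (k : R[i]) x a :
  seqpair_act (k *: x) a = k *: seqpair_act x a.
Proof. by apply: seqpair_ext => n; rewrite !simpE mulrCA. Qed.

Fact seqpair_actZr (k : R[i]) x a :
  seqpair_act x (k *: a) = k *: seqpair_act x a.
Proof. by apply: seqpair_ext => n; rewrite !simpE mulrA. Qed.

Fact seqpair_ipDr x y z :
  seqpair_ip x (y + z) = seqpair_ip x y + seqpair_ip x z.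
Proof. by apply: linfty_ext => n; rewrite !simpE !mulrDr addrACA. Qed.

Fact seqpair_ipZr (k : R[i]) x y :
  seqpair_ip x (k *: y) = k *: seqpair_ip x y.
Proof.
by apply: linfty_ext => n; rewrite !simpE mulrDr [k * (_ * _)]mulrCA
  [k * (_ * _)]mulrCA.
Qed.

Fact seqpair_ip_act x y a :
  seqpair_ip x (seqpair_act y a) = cmul (seqpair_ip x y) a.
Proof. by apply: linfty_ext => n; rewrite !simpE; ring. Qed.

Fact seqpair_ip_star x y : cstar (seqpair_ip x y) = seqpair_ip y x.
Proof.
apply: linfty_ext => n; rewrite !simpE rmorphD !rmorphM /= !conjCK.
by rewrite mulrC [_ * (y.2 n)^*]mulrC.
Qed.

Fact seqpair_ip_positive x : cpositive (seqpair_ip x x).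
Proof. by apply: linfty_positive (seqpair_ip_sqr x) => n; exact: sqr_ge0. Qed.

Fact seqpair_norm_ip x : `|x| ^+ 2 = `|seqpair_ip x x|.
Proof.
rewrite !seqpair_normE -rmorphXn; congr (_%:C); apply/esym/supnorm_sqr => n.
exact: seqpair_ip_sqr.
Qed.

Fact seqpair_ip_eq0 x : seqpair_ip x x = 0 -> x = 0.
Proof.
move=> x0; have : `|x| ^+ 2 == 0 by rewrite seqpair_norm_ip x0 normr0.
by rewrite expf_eq0 /= normr_eq0 => /eqP.
Qed.

HB.instance Definition _ := CompleteNormedModule_isHilbertMod.Build R A E
  seqpair_actM seqpair_actDl seqpair_actDr seqpair_actZl seqpair_actZr
  seqpair_ipDr seqpair_ipZr seqpair_ip_act seqpair_ip_star
  seqpair_ip_positive seqpair_ip_eq0 seqpair_norm_ip.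

Implicit Types p q r : nat -> R[i].

(** The matrix with rows (p, q) and (q, r), symmetric also when its entries are
    not real, which covers the resolvents of diagonal operators. *)
Definition symmx_op p q r x : E :=
  mk_seqpair F (p * x.1 + q * x.2) (q * x.1 + r * x.2).

(** The entry q maps the first, merely bounded, sequence to the second one, so
    it has to vanish along F. *)
Definition admissible p q r := [/\ bdd p, bdd q, bdd r & vanishes F q].

Lemma symmx_opE p q r x : admissible p q r ->
  seqpair_val (symmx_op p q r x) = (p * x.1 + q * x.2, q * x.1 + r * x.2).
Proof.
move=> [bp bq br vq]; rewrite mk_seqpairE//.
- by apply: bddD; exact: bddM.
- by apply: bddD; exact: bddM.
- by apply: vanishesD; [rewrite mulrC|]; exact: vanishesM.
Qed.

Lemma symmx_op1 p q r x n : admissible p q r ->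
  (symmx_op p q r x).1 n = p n * x.1 n + q n * x.2 n.
Proof. by move=> adm; rewrite symmx_opE. Qed.

Lemma symmx_op2 p q r x n : admissible p q r ->
  (symmx_op p q r x).2 n = q n * x.1 n + r n * x.2 n.
Proof. by move=> adm; rewrite symmx_opE. Qed.

Lemma symmx_op_adjoint p q r : admissible p q r ->
  is_adjoint (symmx_op p q r) (symmx_op (fun n => (p n)^*)
    (fun n => (q n)^*) (fun n => (r n)^*)).
Proof.
move=> adm; have adm' : admissible (fun n => (p n)^*)
    (fun n => (q n)^*) (fun n => (r n)^*).
  case: adm => bp bq br vq.
  by split; [exact: bdd_conj..|exact: vanishes_conj].
move=> x y; apply: linfty_ext => n.
rewrite !seqpair_ipE !(symmx_op1, symmx_op2)//.
by rewrite !rmorphD !rmorphM; ring.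
Qed.

Lemma symmx_op_adjointable p q r : admissible p q r ->
  adjointable (symmx_op p q r).
Proof. by move=> /symmx_op_adjoint adj; eexists; exact: adj. Qed.

Definition creal (t : nat -> R) : nat -> R[i] := fun n => (t n)%:C.

Lemma symmx_op_self_adjoint (p q r : nat -> R) :
  admissible (creal p) (creal q) (creal r) ->
  self_adjoint (symmx_op (creal p) (creal q) (creal r)).
Proof.
have conj_creal t : (fun n => (creal t n)^*) = creal t.
  by apply/funext => n; exact: conjc_real.
by move=> /symmx_op_adjoint; rewrite !conj_creal.
Qed.

(** A diagonal operator inverts diagonally, so a scalar off the half-line is in
    its resolvent set as soon as it is in those of both diagonal entries. *)
Lemma diag_op_positive (s t : nat -> R) :
  (forall n, 0 <= s n) -> (forall n, 0 <= t n) ->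
  bdd (creal s) -> bdd (creal t) ->
  op_positive (symmx_op (creal s) (creal (fun=> 0)) (creal t)).
Proof.
move=> s0 t0 bs bt.
have diag p r : bdd p -> bdd r -> admissible p (creal (fun=> 0)) r.
  by move=> bp br; split=> //; [exact: bdd_cst|exact: vanishes0].
have adm := diag _ _ bs bt.
split; [exact: symmx_op_adjointable|exact: symmx_op_self_adjoint|].
move=> l; apply: contra_notT => nl.
have adm' := diag _ _ (bdd_resolvent nl s0) (bdd_resolvent nl t0).
have sl n := resolvent_neq0 nl (s0 n).
have tl n := resolvent_neq0 nl (t0 n).
exists (symmx_op (fun n => ((s n)%:C - l)^-1) (creal (fun=> 0))
   (fun n => ((t n)%:C - l)^-1)); split; first exact: symmx_op_adjointable.
- apply/funext => x; apply: seqpair_ext => n; rewrite /comp.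
    rewrite seqpairD1 seqpairN1 seqpairZ1 !(symmx_op1, symmx_op2)// /creal
      rmorph0.
    by rewrite !(mul0r, mulr0, addr0, add0r); field; exact: sl.
  rewrite seqpairD2 seqpairN2 seqpairZ2 !(symmx_op1, symmx_op2)// /creal
    rmorph0.
  by rewrite !(mul0r, mulr0, addr0, add0r); field; exact: tl.
- apply/funext => x; apply: seqpair_ext => n; rewrite /comp.
    rewrite symmx_op1// seqpairD1 seqpairN1 seqpairZ1 seqpairD2 seqpairN2
      seqpairZ2 !(symmx_op1, symmx_op2)// /creal rmorph0.
    by rewrite !(mul0r, mulr0, addr0, add0r); field; exact: sl.
  rewrite symmx_op2// seqpairD1 seqpairN1 seqpairZ1 seqpairD2 seqpairN2
    seqpairZ2 !(symmx_op1, symmx_op2)// /creal rmorph0.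
  by rewrite !(mul0r, mulr0, addr0, add0r); field; exact: tl.
Qed.

End HilbertModuleOfSequencePairs.

(** * Two lines that merge at infinity *)

Section LineProjection.
Variable R : realType.
Local Notation N := eventually_filterType.
Local Notation E := (seqpair R N).
Implicit Types (c s : nat -> R).

Lemma line_projection_admissible c s :
  (forall n, c n ^+ 2 + s n ^+ 2 = 1) -> vanishes N (creal s) ->
  admissible N (creal (fun n => c n ^+ 2)) (creal (fun n => c n * s n))
    (creal (fun n => s n ^+ 2)).
Proof.
move=> cs1 vs.
have c1 n : `|c n| <= 1.
  by rewrite -(@expr_le1 _ 2)// real_normK ?num_real// -(cs1 n) lerDl sqr_ge0.
have s1 n : `|s n| <= 1.
  by rewrite -(@expr_le1 _ 2)// real_normK ?num_real// -(cs1 n) lerDr sqr_ge0.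
have bc : bdd (creal c) by exists 1 => n; rewrite normc_real.
split.
- by exists 1 => n; rewrite normc_real normrX exprn_ile1.
- by exists 1 => n; rewrite normc_real normrM mulr_ile1.
- by exists 1 => n; rewrite normc_real normrX exprn_ile1.
- have -> : creal (fun n => c n * s n) = creal c * creal s.
    by apply/funext => n; exact: rmorphM.
  exact: vanishesM.
Qed.

(** At each n this is the matrix v v^T of the projection onto the line spanned
    by the unit vector v = (c n, s n), and its square is |v|^2 times itself. *)
Lemma line_projection c s :
  (forall n, c n ^+ 2 + s n ^+ 2 = 1) -> vanishes N (creal s) ->
  projection (symmx_op (creal (fun n => c n ^+ 2)) (creal (fun n => c n * s n))
    (creal (fun n => s n ^+ 2)) : E -> E).
Proof.
move=> cs1 vs; have adm := line_projection_admissible cs1 vs.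
split; [exact: symmx_op_adjointable|exact: symmx_op_self_adjoint|].
apply/funext => x; apply: seqpair_ext => n; rewrite /comp.
  rewrite symmx_op1// [in RHS]symmx_op1// symmx_op1// symmx_op2// /creal.
  transitivity ((c n ^+ 2 + s n ^+ 2)%:C *
    ((c n ^+ 2)%:C * x.1 n + (c n * s n)%:C * x.2 n)); last first.
    by rewrite cs1 mul1r.
  by rewrite !(rmorphXn, rmorphD, rmorphM) /=; ring.
rewrite symmx_op2// [in RHS]symmx_op2// symmx_op1// symmx_op2// /creal.
transitivity ((c n ^+ 2 + s n ^+ 2)%:C *
  ((c n * s n)%:C * x.1 n + (s n ^+ 2)%:C * x.2 n)); last first.
  by rewrite cs1 mul1r.
by rewrite !(rmorphXn, rmorphD, rmorphM) /=; ring.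
Qed.

End LineProjection.

Theorem theorem3p1 (R : realType) :
  exists (A : cstarAlgType R) (H : hilbertModType A) (P Q sqrtPQ : H -> H),
    [/\ projection P,
        projection Q,
        is_positive_sqrt (P \+ Q) sqrtPQ &
        ~ exists X : H -> H, adjointable X /\ sqrtPQ \o X = P].
Proof.
pose s n : R := n.+1%:R^-1.
pose c n : R := Num.sqrt (1 - s n ^+ 2).
have s_gt0 n : 0 < s n by rewrite invr_gt0.
have s_le1 n : s n <= 1 by rewrite invf_le1 ?ler1n.
have c_sqr n : c n ^+ 2 = 1 - s n ^+ 2.
  by rewrite sqr_sqrtr// subr_ge0 exprn_ile1// ltW.
have cs1 n : c n ^+ 2 + s n ^+ 2 = 1 by rewrite c_sqr subrK.
have cNs1 n : c n ^+ 2 + (- s n) ^+ 2 = 1 by rewrite sqrrN.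
have vs : vanishes eventually_filterType (creal s).
  move=> e e0; have := near_infty_natSinv_lt (PosNum e0).
  apply: filterS => n /ltW sn_le.
  by rewrite normc_real ger0_norm ?(ltW (s_gt0 n)).
have vNs : vanishes eventually_filterType (creal (fun n => - s n)).
  move=> e e0; apply: filterS (vs e e0) => n.
  by rewrite !normc_real normrN.
have c_ge0 n : 0 <= c n by exact: sqrtr_ge0.
pose rt2 : R := Num.sqrt 2.
have rt2_sqr : rt2 ^+ 2 = 2 by rewrite sqr_sqrtr.
have rt2_ge0 : 0 <= rt2 by exact: sqrtr_ge0.
have c_le1 n : c n <= 1.
  by rewrite -(@expr_le1 _ 2)// c_sqr gerBl sqr_ge0.
have bc : bdd (creal (fun n => rt2 * c n)).
  by exists rt2 => n; rewrite normc_real ger0_norm ?mulr_ge0// ler_piMr.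
have bs : bdd (creal (fun n => rt2 * s n)).
  by exists rt2 => n; rewrite normc_real ger0_norm ?mulr_ge0 ?ler_piMr// ltW.
have admS : admissible eventually_filterType (creal (fun n => rt2 * c n))
    (creal (fun=> 0)) (creal (fun n => rt2 * s n)).
  by split=> //; [exact: bdd_cst|exact: vanishes0].
have admP := line_projection_admissible cs1 vs.
have admQ := line_projection_admissible cNs1 vNs.
have rt2_sqrC : rt2%:C ^+ 2 = 2%:R by rewrite -rmorphXn rt2_sqr rmorph_nat.
exists (linfty R), (seqpair R eventually_filterType),
  (symmx_op (creal (fun n => c n ^+ 2)) (creal (fun n => c n * s n))
     (creal (fun n => s n ^+ 2))),
  (symmx_op (creal (fun n => c n ^+ 2)) (creal (fun n => c n * - s n))
     (creal (fun n => (- s n) ^+ 2))),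
  (symmx_op (creal (fun n => rt2 * c n)) (creal (fun=> 0))
     (creal (fun n => rt2 * s n))).
split; [exact: line_projection|exact: line_projection| |].
  split.
    by apply: diag_op_positive => // n; rewrite mulr_ge0// ltW.
  apply/funext => x; apply: seqpair_ext => n; rewrite /comp.
    rewrite seqpairD1 !symmx_op1// symmx_op2// /creal
      !(rmorphXn, rmorphN, rmorphM) /=.
    by rewrite rmorph0 -[RHS]/(_ + _); ring: rt2_sqrC.
  rewrite seqpairD2 !symmx_op2// symmx_op1// /creal
    !(rmorphXn, rmorphN, rmorphM) /=.
  by rewrite rmorph0; ring: rt2_sqrC.
move=> [X [_ SXP]].
pose e := mk_seqpair eventually_filterType (fun=> 1 : R[i]) 0.
have eE : seqpair_val e = (fun=> 1, 0).
  by apply: mk_seqpairE; [exact: bdd_cst..|exact: vanishes0].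
have Xe2 n : rt2%:C * (X e).2 n = (c n)%:C.
  have := congr1 (fun T : _ -> seqpair R eventually_filterType => (T e).2 n)
    SXP.
  rewrite /= !symmx_op2// eE /creal /= mul0r add0r mulr1 mulr0 addr0.
  have sn0 : (s n)%:C != 0 by rewrite fmorph_eq0 gt_eqF.
  rewrite !rmorphM => h; apply: (mulfI sn0); rewrite [RHS]mulrC -h; ring.
have half0 : (0 : R) < 1 / 2 by rewrite divr_gt0.
(* At an n with both s n and |y n| at most 1/2, where y := (X e).2, the identity
   2 * |y n|^2 = c n ^ 2 = 1 - s n ^ 2 would bound 3/4 by 1/2. *)
have [n [sn_normc Xn]] :=
  filter_ex (filterI (vs _ half0) (vanishes_snd (X e) half0)).
have sn : s n <= 1 / 2.
  by rewrite -[leLHS]ger0_norm ?(ltW (s_gt0 n))// -normc_real.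
have := congr1 (fun z => normc z ^+ 2) (Xe2 n).
rewrite normcM !exprMn !normc_real !real_normK ?num_real// rt2_sqr c_sqr.
have {Xn} : normc ((X e).2 n) <= 1 / 2 by exact: Xn.
have := normc_ge0 ((X e).2 n); have := s_gt0 n; nra.
Qed.
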